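(* (Leibniz rule.) Let $D\subset\mathbb{C}^n$ be invariant with respect to complex conjugation, let $f,g\in\mathcal{S}(\Omega_D)$ and let $h\in\{1,\dots,n\}$. Then $$(f\odot g)'_{s,h}=f'_{s,h}\odot g^\circ_{s,h}+f^\circ_{s,h}\odot g'_{s,h}$$ (as slice functions on $\Omega_D\setminus\mathbb{R}_h$).
   Context: $\mathbb{H}$ is the algebra of quaternions, $\mathbb{S}_{\mathbb{H}}=\{q\in\mathbb{H}: q^2=-1\}$. $n\ge1$; $\mathcal{P}(n)$ is the set of subsets of $\{1,\dots,n\}$. For $K=\{k_1<\dots<k_p\}\in\mathcal{P}(n)$ and quaternions $q_{k_1},\dots,q_{k_p}$, put $q_K=q_{k_1}\cdots q_{k_p}$ ($q_\emptyset=1$), and $[q_K,a]=q_K\,a$ for $a\in\mathbb{H}$. For $z\in\mathbb{C}^n$, $\overline{z}^h$ is $z$ with its $h$-th coordinate conjugated. $D\subset\mathbb{C}^n$ is invariant with respect to complex conjugation if $z\in D\iff\overline{z}^h\in D$ for every $h$. Its circularization is $\Omega_D=\{(\alpha_l+J_l\beta_l)_{l=1}^n: (\alpha_l+i\beta_l)_{l=1}^n\in D,\ J_1,\dots,J_n\in\mathbb{S}_{\mathbb{H}}\}\subset\mathbb{H}^n$. Let $\{e_K\}_{K\in\mathcal{P}(n)}$ be a basis of $\mathbb{R}^{2^n}$. A stem function is $F=\sum_{K}e_KF_K:D\to\mathbb{H}\otimes\mathbb{R}^{2^n}$, $F_K:D\to\mathbb{H}$, with $F_K(\overline{z}^h)=(-1)^{|K\cap\{h\}|}F_K(z)$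 for all $K,h,z$. $F$ induces the slice function $f=\mathcal{I}(F):\Omega_D\to\mathbb{H}$, $f(x)=\sum_K[J_K,F_K(z)]$ for $x=(\alpha_l+J_l\beta_l)_l$, $z=(\alpha_l+i\beta_l)_l\in D$. $\mathcal{S}(\Omega_D)$ is the set of slice functions; each slice function is induced by a unique stem function. Slice product: for stem functions $F,G$ put $(F\otimes G)(z)=\sum_{H,K\in\mathcal{P}(n)}(-1)^{|H\cap K|}e_{H\Delta K}F_H(z)G_K(z)$ with $H\Delta K=(H\cup K)\setminus(H\cap K)$; this is again a stem function, and $\mathcal{I}(F)\odot\mathcal{I}(G):=\mathcal{I}(F\otimes G)$ (functions being restricted to a common domain when necessary). $\mathbb{R}_h$ denotes the set of points whose $h$-th coordinate is real. For $f=\mathcal{I}(F)$, the spherical $x_h$-value is $f^\circ_{s,h}=\mathcal{I}(F^\circ_h)\in\mathcal{S}(\Omega_D)$, with $F^\circ_h(z)=\sum_{K\in\mathcal{P}(n),\,h\notin K}e_KF_K(z)$, and the spherical $x_h$-derivative is $f'_{s,h}=\mathcal{I}(F'_h)\in\mathcal{S}(\Omega_D\setminus\mathbb{R}_h)$, with $F'_h(z)=\beta_h^{-1}\sum_{K\in\mathcal{P}(n),\,h\notin K}e_KF_{K\cup\{h\}}(z)$ for $z\in D\setminus\mathbb{R}_h$, $z_h=\alpha_h+i\beta_h$. *)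

(* Defs.v *)
From HB Require Import structures.
From mathcomp Require Import all_boot all_order all_algebra.
From mathcomp Require Import boolp classical_sets reals.
From mathcomp Require Import complex.
From mathcomp Require Import ring.

Set Implicit Arguments.
Unset Strict Implicit.
Unset Printing Implicit Defensive.

Import Order.TTheory GRing.Theory Num.Theory.
Local Open Scope classical_set_scope.
Local Open Scope ring_scope.

(* Quat a b c d stands for a + b i + c j + d k. *)
Record quat (R : Type) : Type := Quat { q1 : R; qi : R; qj : R; qk : R }.

Definition quat_tuple (R : Type) (q : quat R) : R * R * R * R :=
  (q1 q, qi q, qj q, qk q).

Definition tuple_quat (R : Type) (t : R * R * R * R) : quat R :=
  let: (a, b, c, d) := t in Quat a b c d.

Lemma quat_tupleK (R : Type) : cancel (@quat_tuple R) (@tuple_quat R).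
Proof. by case. Qed.

HB.instance Definition _ (R : eqType) :=
  Equality.copy (quat R) (can_type (@quat_tupleK R)).
HB.instance Definition _ (R : choiceType) :=
  Choice.copy (quat R) (can_type (@quat_tupleK R)).

Section QuaternionAlgebra.
Variable R : comNzRingType.
Implicit Types (p q r : quat R) (a b : R).

Definition quat_zero : quat R := Quat 0 0 0 0.
Definition quat_one : quat R := Quat 1 0 0 0.

Definition quat_opp p := Quat (- q1 p) (- qi p) (- qj p) (- qk p).

Definition quat_add p q :=
  Quat (q1 p + q1 q) (qi p + qi q) (qj p + qj q) (qk p + qk q).

Definition quat_mul p q := Quat
  (q1 p * q1 q - qi p * qi q - qj p * qj q - qk p * qk q)
  (q1 p * qi q + qi p * q1 q + qj p * qk q - qk p * qj q)
  (q1 p * qj q - qi p * qk q + qj p * q1 q + qk p * qi q)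
  (q1 p * qk q + qi p * qj q - qj p * qi q + qk p * q1 q).

Definition quat_scale a p := Quat (a * q1 p) (a * qi p) (a * qj p) (a * qk p).

Fact quat_addA : associative quat_add.
Proof. by move=> p q r; congr Quat; rewrite /= addrA. Qed.

Fact quat_addC : commutative quat_add.
Proof. by move=> p q; congr Quat; rewrite /= addrC. Qed.

Fact quat_add0 : left_id quat_zero quat_add.
Proof. by case=> *; congr Quat; rewrite /= add0r. Qed.

Fact quat_addN : left_inverse quat_zero quat_opp quat_add.
Proof. by move=> p; congr Quat; rewrite /= addNr. Qed.

HB.instance Definition _ :=
  GRing.isZmodule.Build (quat R) quat_addA quat_addC quat_add0 quat_addN.

Fact quat_mulA : associative quat_mul.
Proof. by move=> p q r; congr Quat; rewrite /=; ring. Qed.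

Fact quat_mul1l : left_id quat_one quat_mul.
Proof. by case=> *; congr Quat; rewrite /=; ring. Qed.

Fact quat_mul1r : right_id quat_one quat_mul.
Proof. by case=> *; congr Quat; rewrite /=; ring. Qed.

Fact quat_mulDl : left_distributive quat_mul +%R.
Proof. by move=> p q r; congr Quat; rewrite /=; ring. Qed.

Fact quat_mulDr : right_distributive quat_mul +%R.
Proof. by move=> p q r; congr Quat; rewrite /=; ring. Qed.

Fact quat_one_neq0 : quat_one != 0.
Proof. by apply/eqP => -[/eqP]; rewrite oner_eq0. Qed.

HB.instance Definition _ := GRing.Zmodule_isNzRing.Build (quat R)
  quat_mulA quat_mul1l quat_mul1r quat_mulDl quat_mulDr quat_one_neq0.

Fact quat_scaleA a b p : quat_scale a (quat_scale b p) = quat_scale (a * b) p.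
Proof. by congr Quat; rewrite /= mulrA. Qed.

Fact quat_scale1 : left_id 1 quat_scale.
Proof. by case=> *; congr Quat; rewrite /= mul1r. Qed.

Fact quat_scaleDr : right_distributive quat_scale +%R.
Proof. by move=> a p q; congr Quat; rewrite /= mulrDr. Qed.

Fact quat_scaleDl p : {morph quat_scale^~ p : a b / a + b}.
Proof. by move=> a b; congr Quat; rewrite /= mulrDl. Qed.

HB.instance Definition _ := GRing.Zmodule_isLmodule.Build R (quat R)
  quat_scaleA quat_scale1 quat_scaleDr quat_scaleDl.

Fact quat_scaleAl a p q : a *: (p * q) = (a *: p) * q.
Proof. by congr Quat; rewrite /=; ring. Qed.

HB.instance Definition _ :=
  GRing.Lmodule_isLalgebra.Build R (quat R) quat_scaleAl.

Fact quat_scaleAr a p q : a *: (p * q) = p * (a *: q).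
Proof. by congr Quat; rewrite /=; ring. Qed.

HB.instance Definition _ :=
  GRing.Lalgebra_isAlgebra.Build R (quat R) quat_scaleAr.

End QuaternionAlgebra.

Section SliceFunctions.
Variables (R : realType) (n : nat).

Local Notation H := (quat R).
Local Notation Cn := 'rV[R[i]]_n.
Local Notation Hn := 'rV[quat R]_n.
(* H (x) R^(2^n): the coordinate at K is the quaternion coefficient of e_K. *)
Local Notation H2n := {ffun {set 'I_n} -> quat R}.

Implicit Types (D : set Cn) (F G : Cn -> H2n) (f g : Hn -> H) (h : 'I_n).

Definition imag_units : set H := [set q | q ^+ 2 = -1].

Definition conj_at h (z : Cn) : Cn :=
  \row_l (if l == h then conjc (z 0 l) else z 0 l).

Definition conj_invariant D : Prop := forall (z : Cn) h, D z <-> D (conj_at h z).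

(* (alpha_l + J_l beta_l)_l, where z = (alpha_l + i beta_l)_l *)
Definition slice_point (z : Cn) (J : Hn) : Hn :=
  \row_l ((complex.Re (z 0 l))%:A + complex.Im (z 0 l) *: J 0 l).

Definition circularization D : set Hn :=
  [set x | exists (z : Cn) (J : Hn),
    [/\ D z, forall l, imag_units (J 0 l) & x = slice_point z J]].

(* The factors are multiplied by increasing index, the order in which 'I_n is
   enumerated. *)
Definition ordered_prod (K : {set 'I_n}) (q : Hn) : H := \prod_(k in K) q 0 k.

Definition bracket (q a : H) : H := q * a.

(* e_K (x) a *)
Definition e_ (K : {set 'I_n}) (a : H) : H2n :=
  [ffun L => if L == K then a else 0].

Definition stem D F : Prop := forall (K : {set 'I_n}) h (z : Cn), D z ->
  F (conj_at h z) K = (-1) ^+ #|K :&: [set h]| * F z K.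

Definition slice_value F (z : Cn) (J : Hn) : H :=
  \sum_(K : {set 'I_n}) bracket (ordered_prod K J) (F z K).

(* f is a function on all of H^n; only its restriction to the circularization
   of D is relevant. *)
Definition induces D F f : Prop := forall (z : Cn) (J : Hn),
  D z -> (forall l, imag_units (J 0 l)) ->
  f (slice_point z J) = slice_value F z J.

Definition slice D f : Prop := exists2 F, stem D F & induces D F f.

(* I(F): for a stem function F on an invariant D, the value at x does not depend
   on the representation of x by z and J.  The value is 0 outside the
   circularization of D. *)
Definition slice_of D F : Hn -> H := fun x =>
  xget 0 [set v | exists (z : Cn) (J : Hn),
    [/\ D z, forall l, imag_units (J 0 l), x = slice_point z J
      & v = slice_value F z J]].

(* The stem function inducing f on the circularization of D, unique on D;
   meaningful when D is invariant and f is slice on D. *)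
Definition stem_of D f : Cn -> H2n :=
  xget (fun _ => 0) [set F | stem D F /\ induces D F f].

Definition symdiff (A B : {set 'I_n}) : {set 'I_n} :=
  (A :|: B) :\: (A :&: B).

Definition stem_prod F G : Cn -> H2n := fun z =>
  \sum_(A : {set 'I_n}) \sum_(B : {set 'I_n})
    e_ (symdiff A B) ((-1) ^+ #|A :&: B| * F z A * G z B).

(* Slice product on the circularization of D of (the restrictions of) f and g. *)
Definition slice_prod D f g : Hn -> H :=
  slice_of D (stem_prod (stem_of D f) (stem_of D g)).

Definition real_at_C h : set Cn := [set z | complex.Im (z 0 h) = 0].

Definition real_at_H h : set Hn := [set x | exists a : R, x 0 h = a%:A].

Definition stem_spherical_value h F : Cn -> H2n := fun z =>
  \sum_(K : {set 'I_n} | h \notin K) e_ K (F z K).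

Definition stem_spherical_derivative h F : Cn -> H2n := fun z =>
  (complex.Im (z 0 h))^-1 *:
    \sum_(K : {set 'I_n} | h \notin K) e_ K (F z (h |: K)).

Definition spherical_value D h f : Hn -> H :=
  slice_of D (stem_spherical_value h (stem_of D f)).

Definition spherical_derivative D h f : Hn -> H :=
  slice_of (D `\` real_at_C h) (stem_spherical_derivative h (stem_of D f)).

End SliceFunctions.

(* Main.v *)
Require Import Defs.
From mathcomp Require Import all_boot all_order all_algebra.
From mathcomp Require Import boolp classical_sets reals.
From mathcomp Require Import complex.
From mathcomp Require Import ring lra.

(** On stem functions the rule is an identity between finite sums.  Fix [z] with
    [beta_h = Im z_h] nonzero.  The coefficient of [F (x) G] at [{h} u K], with
    [h] not in [K], collects the products [F_A G_B] over the pairs [A], [B]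
    with symmetric difference [{h} u K], so exactly one of them contains [h];
    removing [h] from it turns the pair into a pair [A], [B] free of [h] with
    symmetric difference [K], and leaves the sign [(-1)^|A n B|] unchanged.
    Dividing by [beta_h], the pairs with [h] in the first set give
    [F'_h (x) G_h] and those with [h] in the second one give [F_h (x) G'_h],
    where [F_h], [G_h] are the stem functions of the spherical values.  This is
    [stem_leibniz].

    The passage to slice functions needs that [F |-> I(F)] is well defined and
    injective, since products and derivatives of slice functions are defined
    through their stem functions.

    Well defined ([slice_value_wd]): if [alpha_l + J_l beta_l] is also
    [alpha'_l + J'_l beta'_l], then [alpha'_l = alpha_l] and, for some sign
    [s_l], [beta'_l = s_l beta_l] and, unless [beta_l = 0], [J'_l = s_l J_l].
    The symmetry of a stem function compensates the signs, and it makes [F_K]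
    vanish where [beta_l = 0] for some [l] in [K], so that the arbitrary choice
    of [J_l] there does not matter.

    Injective ([induces_inj]): evaluate at [J_l = +i] or [-i], the minus sign
    being taken for [l] in [S].  This gives, for every [S], the sum over [K] of
    [(-1)^|K n S| i^|K| F_K(z)]; the sign characters [(-1)^|K n S|] are
    orthogonal, so the coefficients are determined by these sums
    ([sign_transform_inj]). *)

Import Order.TTheory GRing.Theory Num.Theory.
Local Open Scope classical_set_scope.
Local Open Scope ring_scope.

(** * Sign characters of the group of subsets *)

Section Signs.
Set Implicit Arguments.
Unset Strict Implicit.

Lemma sign_cardI (R : comNzRingType) (T : finType) (A B : {set T}) :
  (-1) ^+ #|A :&: B| = \prod_(i in A) (-1) ^+ (i \in B) :> R.
Proof.
rewrite (big_setID B) /= (eq_bigr (fun=> -1)) => [|i]; last first.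
  by rewrite inE => /andP[_ ->].
rewrite prodr_const big1 ?mulr1 // => i.
by rewrite inE => /andP[/negbTE->].
Qed.

(** Written as a product over [i] of [1 + s_i], where [s_i] is [-1] exactly when
    [i] lies in one of [K], [L] only, the sum over [S] vanishes as soon as one
    such [i] exists. *)
Lemma sign_orthogonality (R : comNzRingType) (T : finType) (K L : {set T}) :
  \sum_(S : {set T}) (-1) ^+ #|S :&: L| * (-1) ^+ #|S :&: K|
    = (if K == L then 2 ^+ #|T| else 0) :> R.
Proof.
under eq_bigr => S _ do
  rewrite !sign_cardI -big_split /= big_mkcond /=.
rewrite -(@bigA_distr _ _ _ *%R +%R) /=; case: eqP => [->|neqKL].
  rewrite -prodr_const; apply: eq_bigr => i _.
  by rewrite -expr2 sqrr_sign.
have [i neqi] : exists i, (i \in K) != (i \in L).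
  apply/existsP; apply: contra_notT neqKL => /existsPn eqKL.
  by apply/setP => i; apply/eqP/negPn/eqKL.
rewrite (bigD1 i) //=; move: neqi.
by case: (i \in K); case: (i \in L) => // _;
  rewrite !(expr0, expr1, mulr1, mul1r) addNr mul0r.
Qed.

(** The Walsh-Hadamard transform is inverted, up to the factor [2^|T|], by
    applying it again. *)
Lemma sign_transform_inj (R : realType) (V : lmodType R) (T : finType)
    (a : {set T} -> V) :
  (forall S : {set T}, \sum_(K : {set T}) (-1) ^+ #|K :&: S| *: a K = 0) ->
  forall L, a L = 0.
Proof.
move=> a0 L.
have : \sum_(S : {set T}) (-1) ^+ #|S :&: L| *:
         \sum_(K : {set T}) (-1) ^+ #|K :&: S| *: a K = 0.
  by apply: big1 => S _; rewrite a0 scaler0.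
under eq_bigr => S _ do
  (rewrite scaler_sumr;
   under eq_bigr => K _ do rewrite scalerA (finset.setIC K)).
rewrite exchange_big /=.
under eq_bigr => K _ do rewrite -scaler_suml sign_orthogonality.
rewrite (bigD1 L) //= eqxx big1 ?addr0 => [/eqP|K /negbTE->]; last first.
  by rewrite scale0r.
by rewrite scaler_eq0 expf_eq0 pnatr_eq0 andbF => /eqP.
Qed.

(** Signs occur as ring elements in stem functions; as real scalars they can be
    moved across quaternion products. *)
Lemma mul_signZ (R : pzRingType) (A : lalgType R) k (a : A) :
  (-1) ^+ k * a = (-1) ^+ k *: a.
Proof. by rewrite -(signr_odd A) -(signr_odd R) mulr_sign scaler_sign. Qed.

End Signs.

(** * Points with given slice coordinates *)

Section Slice.
Set Implicit Arguments.
Unset Strict Implicit.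
Variables (R : realType) (n : nat).
Local Notation H := (quat R).
Local Notation Cn := 'rV[R[i]]_n.
Local Notation Hn := 'rV[quat R]_n.
Local Notation H2n := {ffun {set 'I_n} -> quat R}.
Implicit Types (D : set Cn) (F G : Cn -> H2n) (h : 'I_n) (z : Cn) (J : Hn).

(** If [q^2 = -1] and [q] had nonzero real part, its vector part would vanish
    and [q^2] would be a nonnegative real. *)
Lemma imag_unitsP (q : H) : imag_units q ->
  q1 q = 0 /\ qi q ^+ 2 + qj q ^+ 2 + qk q ^+ 2 = 1.
Proof.
case: q => a b c d; rewrite /imag_units /= expr2 => -[/= e1 ei ej ek].
suff a0 : a = 0 by split=> //; move: e1; rewrite a0; nra.
have : a ^+ 2 * (a ^+ 2 + 1) = 0 by nra.
move/eqP; rewrite mulf_eq0 expf_eq0 /= => /orP[/eqP //|/eqP].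
by nra.
Qed.

(** Comparing norms of the vector parts gives [b'^2 = b^2].  The sign relating
    the two presentations is read off from whether [b'] equals [b]; when [b = 0]
    it is [+1] and [q'] is unconstrained. *)
Lemma slice_coord_eq (a b a' b' : R) (q q' : H) :
  imag_units q -> imag_units q' -> a%:A + b *: q = a'%:A + b' *: q' ->
  [/\ a' = a, b' = (-1) ^+ (b' != b) * b &
      b != 0 -> q' = (-1) ^+ (b' != b) *: q].
Proof.
move=> /imag_unitsP[] + + /imag_unitsP[].
case: q => x y z t; case: q' => x' y' z' t' /= -> nq -> nq' [].
rewrite /= !mulr0 !mulr1 !add0r !addr0 => ea ei ej ek.
have : b' ^+ 2 = b ^+ 2.
  rewrite -[RHS]mulr1 -nq -[LHS]mulr1 -nq' !mulrDr -!exprMn.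
  by rewrite ei ej ek.
have cancel_b (c d : R) : b != 0 -> b * c = b * d -> d = c.
  by move=> b0 /(mulfI b0) ->.
move/eqP; rewrite eqf_sqr; case: eqP => [eb _|_ /= /eqP eb].
  split=> [//||b0]; first by rewrite expr0 mul1r.
  rewrite scale1r; move: ei ej ek; rewrite eb.
  by do 3![move=> /(cancel_b _ _ b0) ->].
split=> [//||b0]; first by rewrite mulN1r.
rewrite expr1 scaleN1r; move: ei ej ek; rewrite eb !mulNr -!mulrN.
do 3![move=> /(cancel_b _ _ b0) <-].
by congr Quat; rewrite /= ?oppr0 ?opprK.
Qed.

(** * Well-definedness of the induced slice function *)

Definition conj_on (S : {set 'I_n}) (z : Cn) : Cn :=
  \row_l (if l \in S then conjc (z 0 l) else z 0 l).

Lemma stem_conj_on D F (S : {set 'I_n}) z : conj_invariant D -> stem D F ->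
  D z -> D (conj_on S z) /\
    forall K, F (conj_on S z) K = (-1) ^+ #|K :&: S| *: F z K.
Proof.
move=> invD stemF Dz; have [m] := ubnP #|S|; elim: m S => // m IHm S ltSm.
have [->|[h hS]] := set_0Vmem S.
  have -> : conj_on finset.set0 z = z by apply/rowP => l; rewrite mxE inE.
  by split=> // K; rewrite finset.setI0 cards0 scale1r.
have -> : conj_on S z = conj_at h (conj_on (S :\ h) z).
  apply/rowP => l; rewrite !mxE !inE; case: eqP => [->|] //=.
  by rewrite hS.
have [|DS FS] := IHm (S :\ h).
  by move: ltSm; rewrite (cardsD1 h S) hS.
split; first exact: (proj1 (invD _ h)).
move=> K; rewrite stemF // FS mul_signZ scalerA -exprD; congr (_ ^+ _ *: _).
rewrite -(cardsID [set h] (K :&: S)); congr (_ + _)%N; apply: eq_card => l.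
  by rewrite !inE; case: eqP => [->|]; rewrite ?hS ?andbF ?andbT.
by rewrite !inE; case: eqP => [->|]; rewrite ?hS ?andbF ?andbT.
Qed.

Lemma ordered_prod_sign (K S : {set 'I_n}) J J' :
  (forall k, k \in K -> J' 0 k = (-1) ^+ (k \in S) *: J 0 k) ->
  ordered_prod K J' = (-1) ^+ #|K :&: S| *: ordered_prod K J.
Proof.
by move=> eJ; rewrite /ordered_prod (eq_bigr _ eJ) scaler_prod -sign_cardI.
Qed.

(** Here [z] is its own conjugate at [h], so [F_K z = - F_K z]. *)
Lemma stem_real_eq0 D F z h (K : {set 'I_n}) :
  stem D F -> D z -> complex.Im (z 0 h) = 0 -> h \in K -> F z K = 0.
Proof.
move=> stemF Dz zh hK.
have ez : conj_at h z = z.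
  apply/rowP => l; rewrite mxE; case: eqP => // ->.
  by case: (z 0 h) zh => a b /= ->; rewrite oppr0.
have hKI : K :&: [set h] = [set h]%SET.
  by apply/finset.setIidPr; rewrite finset.sub1set.
have := stemF K h z Dz; rewrite ez hKI cards1.
rewrite mulN1r => /eqP; rewrite -subr_eq0 opprK -mulr2n -scaler_nat.
by rewrite scaler_eq0 pnatr_eq0 => /eqP.
Qed.

(** [S] is the set of coordinates at which the two presentations differ by a
    sign; [F_K] and the product of the units [J_k] both change by
    [(-1)^|K n S|], unless some [k] in [K] is a real coordinate, and then both
    terms are zero. *)
Lemma slice_value_wd D F z z' J J' : conj_invariant D -> stem D F ->
  D z -> D z' ->
  (forall l, imag_units (J 0 l)) -> (forall l, imag_units (J' 0 l)) ->
  slice_point z J = slice_point z' J' ->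
  slice_value F z J = slice_value F z' J'.
Proof.
move=> invD stemF Dz Dz' uJ uJ' ex.
pose S := [set l | complex.Im (z' 0 l) != complex.Im (z 0 l)]%SET.
have coord l : [/\ complex.Re (z' 0 l) = complex.Re (z 0 l),
    complex.Im (z' 0 l) = (-1) ^+ (l \in S) * complex.Im (z 0 l) &
    complex.Im (z 0 l) != 0 -> J' 0 l = (-1) ^+ (l \in S) *: J 0 l].
  rewrite inE; apply: slice_coord_eq => //.
  by move/rowP: ex => /(_ l); rewrite !mxE.
have ez : z' = conj_on S z.
  apply/rowP => l; rewrite mxE; have [eR eI _] := coord l.
  move: eR eI; case: (z' 0 l) => a' b'; case: (z 0 l) => a b /= -> ->.
  by case: (l \in S); rewrite ?mulN1r ?mul1r.
have [_ FS] := stem_conj_on S invD stemF Dz.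
apply: eq_bigr => K _; rewrite /bracket ez FS.
have [/existsP[k /andP[kK /eqP k0]]|/existsPn noreal] :=
    boolP [exists k, (k \in K) && (complex.Im (z 0 k) == 0)].
  by rewrite (stem_real_eq0 stemF Dz k0 kK) scaler0 !mulr0.
rewrite (@ordered_prod_sign K S J J') => [|k kK]; last first.
  have [_ _ ->] := coord k => //.
  by have := noreal k; rewrite kK.
by rewrite -scalerAl -scalerAr scalerA -expr2 sqrr_sign scale1r.
Qed.

Lemma slice_of_induces D F : conj_invariant D -> stem D F ->
  induces D F (slice_of D F).
Proof.
move=> invD stemF z J Dz uJ; rewrite /slice_of; apply: xget_unique => [|v /=].
  by exists z, J.
move=> [z' [J' [Dz' uJ' ex ->]]].
exact/esym/(slice_value_wd invD stemF).
Qed.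

(** * Uniqueness of the stem function *)

Lemma induces_inj D F G f : induces D F f -> induces D G f ->
  {in D, F =1 G}.
Proof.
move=> indF indG z; rewrite inE => Dz; apply/ffunP => K.
pose iq : H := Quat 0 1 0 0.
have iq2 : iq ^+ 2 = -1 by rewrite expr2; congr Quat => /=; ring.
(* Multiplying by i^|L| makes the orthogonality relation applicable; this is
   undone by a second multiplication, since i^(2|L|) is a sign. *)
pose a (L : {set 'I_n}) := iq ^+ #|L| * (F z L - G z L).
suff aK : a K = 0.
  have := congr1 ( *%R (iq ^+ #|K|)) aK.
  rewrite /a mulrA -exprD addnn -mul2n exprM iq2 mulr0 => /eqP.
  rewrite mul_signZ scaler_eq0 signr_eq0 subr_eq0.
  by move/eqP.
apply: sign_transform_inj => S.
pose J : Hn := \row_l ((-1) ^+ (l \in S) *: iq).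
have uJ l : imag_units (J 0 l).
  by rewrite /imag_units /= mxE exprZn sqrr_sign scale1r.
have := etrans (esym (indF z J Dz uJ)) (indG z J Dz uJ).
move/eqP; rewrite -subr_eq0 /slice_value -sumrB => /eqP e0.
apply: (etrans _ e0).
apply: eq_bigr => L _; rewrite /bracket -mulrBr /a scalerAl.
rewrite (@ordered_prod_sign L S (const_mx iq)) => [|k _]; last by rewrite !mxE.
congr (_ *: _ * _); rewrite /ordered_prod (eq_bigr (fun=> iq)) => [|k _].
  by rewrite prodr_const.
by rewrite mxE.
Qed.

Lemma stem_ofP D f : slice D f ->
  stem D (stem_of D f) /\ induces D (stem_of D f) f.
Proof.
move=> [F sF iF].
suff : [set F | stem D F /\ induces D F f] (stem_of D f) by [].
by apply: xgetPex; exists F.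
Qed.

Lemma stem_of_eq D F f : stem D F -> induces D F f ->
  {in D, stem_of D f =1 F}.
Proof.
move=> sF iF; have [|_ i'] := @stem_ofP D f; first by exists F.
exact: induces_inj i' iF.
Qed.

Lemma stem_sub D D' F : D' `<=` D -> stem D F -> stem D' F.
Proof. by move=> sD sF K h z /sD; apply: sF. Qed.

Lemma induces_sub D D' F f : D' `<=` D -> induces D F f -> induces D' F f.
Proof. by move=> sD iF z J /sD; apply: iF. Qed.

(** Restricting a slice function to a smaller invariant set restricts its stem
    function; this is how the two factors, one on [D] and one on [D] minus the
    real points, are multiplied on the smaller set. *)
Lemma stem_of_slice_of D D' F : conj_invariant D -> D' `<=` D -> stem D F ->
  {in D', stem_of D' (slice_of D F) =1 F}.
Proof.
move=> invD sD sF; apply: stem_of_eq; first exact: stem_sub sF.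
exact/(induces_sub sD)/slice_of_induces.
Qed.

(** [stem_of] is determined on [D] only, so computations with it give equalities
    on [D], which suffice here. *)
Lemma slice_of_eq D F F' z J : conj_invariant D -> stem D F' ->
  {in D, F =1 F'} -> D z -> (forall l, imag_units (J 0 l)) ->
  slice_of D F (slice_point z J) = slice_value F' z J.
Proof.
move=> invD sF' eF Dz uJ; have inD y : D y -> y \in D by rewrite inE.
have sF : stem D F.
  move=> K l y Dy; have Dcy : D (conj_at l y) by apply: (proj1 (invD y l)).
  by rewrite (eF _ (inD _ Dy)) (eF _ (inD _ Dcy)) sF'.
rewrite (slice_of_induces invD sF) // /slice_value.
by apply: eq_bigr => K _; rewrite eF // inD.
Qed.

(** * The stem functions of products, spherical values and derivatives *)

Lemma in_symdiff (A B : {set 'I_n}) l :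
  (l \in symdiff A B) = (l \in A) (+) (l \in B).
Proof. by rewrite !inE; case: (l \in A); case: (l \in B). Qed.

Lemma symdiffU1l h (A B : {set 'I_n}) : h \notin B ->
  symdiff (h |: A) B = h |: symdiff A B.
Proof.
move=> /negbTE hB; apply/setP => l; rewrite in_symdiff !in_setU1 in_symdiff.
by case: eqP => [->|//]; rewrite hB.
Qed.

Lemma symdiffU1r h (A B : {set 'I_n}) : h \notin A ->
  symdiff A (h |: B) = h |: symdiff A B.
Proof.
move=> /negbTE hA; apply/setP => l; rewrite in_symdiff !in_setU1 in_symdiff.
by case: eqP => [->|//]; rewrite hA.
Qed.

Lemma setI_set1 h (K : {set 'I_n}) : #|K :&: [set h]| = (h \in K).
Proof.
have [hK|hK] := boolP (h \in K).
  by rewrite (finset.setIidPr _) ?finset.sub1set ?cards1.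
apply/eqP; rewrite cards_eq0 finset.setI_eq0 disjoint_sym.
by rewrite disjoints1.
Qed.

Lemma setI1U h (A B : {set 'I_n}) : h \notin B -> (h |: A) :&: B = A :&: B.
Proof.
move=> /negbTE hB; apply/setP => l; rewrite !inE.
by case: eqP => [->|//]; rewrite hB !andbF.
Qed.

(** Subsets come in pairs [A], [{h} u A] with [h] not in [A]. *)
Lemma sum_setU1 (V : nmodType) h (phi : {set 'I_n} -> V) :
  \sum_(A : {set 'I_n}) phi A
    = \sum_(A : {set 'I_n} | h \notin A) (phi A + phi (h |: A)).
Proof.
rewrite (bigID (fun A : {set 'I_n} => h \notin A)) /= big_split /=.
congr (_ + _).
rewrite (reindex_onto (fun A : {set 'I_n} => h |: A)
  (fun A : {set 'I_n} => A :\ h)) /=; last first.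
  by move=> A /negPn; apply: finset.setD1K.
apply: eq_bigl => A; rewrite negbK finset.setU11 /=.
by apply/eqP/idP => [<-|/finset.setU1K //]; rewrite !inE eqxx.
Qed.

Lemma sum_e_E (P : pred {set 'I_n}) (a : {set 'I_n} -> H) (K : {set 'I_n}) :
  (\sum_(L | P L) e_ L (a L)) K = if P K then a K else 0.
Proof.
rewrite sum_ffunE big_mkcond (bigD1 K) //= big1 ?addr0 => [|L /negbTE neqL].
  by rewrite ffunE eqxx.
by rewrite ffunE eq_sym neqL if_same.
Qed.

Lemma stem_spherical_valueE h F z (K : {set 'I_n}) :
  stem_spherical_value h F z K = if h \notin K then F z K else 0.
Proof. exact: sum_e_E. Qed.

Lemma stem_spherical_derivativeE h F z (K : {set 'I_n}) :
  stem_spherical_derivative h F z K =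
    if h \notin K then (complex.Im (z 0 h))^-1 *: F z (h |: K) else 0.
Proof. by rewrite ffunE sum_e_E; case: ifP; rewrite ?scaler0. Qed.

Lemma stem_prodE F G z (K : {set 'I_n}) :
  stem_prod F G z K = \sum_(A : {set 'I_n}) \sum_(B : {set 'I_n})
    if K == symdiff A B then (-1) ^+ #|A :&: B| *: (F z A * G z B) else 0.
Proof.
rewrite sum_ffunE; apply: eq_bigr => A _; rewrite sum_ffunE.
by apply: eq_bigr => B _; rewrite ffunE -mulrA mul_signZ.
Qed.

Lemma stem_spherical_value_stem D h F : stem D F ->
  stem D (stem_spherical_value h F).
Proof.
move=> sF K l z Dz; rewrite !stem_spherical_valueE sF //.
by case: ifP; rewrite ?mulr0.
Qed.

Lemma conj_invariantD D h : conj_invariant D ->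
  conj_invariant (D `\` real_at_C h).
Proof.
move=> invD z l; rewrite /real_at_C /setD /= mxE.
have -> : complex.Im (if h == l then conjc (z 0 h) else z 0 h) = 0 <->
    complex.Im (z 0 h) = 0.
  case: eqP => // _; case: (z 0 h) => a b /=.
  split=> [/eqP|->]; rewrite ?oppr0 //.
  by rewrite oppr_eq0 => /eqP.
by have := invD z l; tauto.
Qed.

(** For conjugation in the coordinate [h], the change of sign of [F] at
    [{h} u K] is absorbed by that of the factor [beta_h^-1]. *)
Lemma stem_spherical_derivative_stem D h F : stem D F ->
  stem D (stem_spherical_derivative h F).
Proof.
move=> sF K l z Dz; rewrite !stem_spherical_derivativeE sF //.
case: ifP => [hK|_]; last by rewrite mulr0.
rewrite mxE !setI_set1 !mul_signZ !scalerA in_setU1 eq_sym.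
congr (_ *: _); case: eqP => [->|_] /=; last by rewrite mulrC.
rewrite (negbTE hK) expr0 expr1 mul1r mulrN1.
by case: (z 0 h) => a b /=; rewrite invrN opprK.
Qed.

(** [A |-> (-1)^|A n {l}|] is multiplicative for the symmetric difference. *)
Lemma stem_prod_stem D F G : stem D F -> stem D G -> stem D (stem_prod F G).
Proof.
move=> sF sG K l z Dz; rewrite !stem_prodE mul_signZ scaler_sumr.
apply: eq_bigr => A _; rewrite scaler_sumr; apply: eq_bigr => B _.
case: eqP => [->|_]; last by rewrite scaler0.
rewrite sF // sG // !mul_signZ !setI_set1 in_symdiff.
rewrite -scalerAl -scalerAr !scalerA; congr (_ *: _).
by case: (l \in A); case: (l \in B); rewrite /= ?expr0 ?expr1; ring.
Qed.

Lemma eq_stem_prod F F' G G' z : F z = F' z -> G z = G' z ->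
  stem_prod F G z = stem_prod F' G' z.
Proof. by rewrite /stem_prod => -> ->. Qed.

(** * The Leibniz rule *)

(** Among the four pairs obtained from [A], [B] free of [h] by adding [h] to
    some of them, only the two in which [h] is added to a single set have a
    symmetric difference containing [h]. *)
Lemma stem_prod_setU1 h F G z (K : {set 'I_n}) : h \notin K ->
  stem_prod F G z (h |: K) =
    \sum_(A : {set 'I_n} | h \notin A) \sum_(B : {set 'I_n} | h \notin B)
      if K == symdiff A B
      then (-1) ^+ #|A :&: B| *: (F z (h |: A) * G z B + F z A * G z (h |: B))
      else 0.
Proof.
move=> hK; rewrite stem_prodE (sum_setU1 h); apply: eq_bigr => A hA.
rewrite !(sum_setU1 h) -big_split; apply: eq_bigr => B hB /=.
have hAB : h \notin symdiff A B by rewrite in_symdiff (negbTE hA) (negbTE hB).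
have eqU1 : (h |: K == h |: symdiff A B) = (K == symdiff A B).
  apply/eqP/eqP => [e|-> //].
  by rewrite -(finset.setU1K hK) e finset.setU1K.
have neqU1 (L : {set 'I_n}) : h \notin L -> (h |: K == L) = false.
  by move=> hL; apply: contraNF hL => /eqP <-; apply: finset.setU11.
have hAhB : h \notin symdiff (h |: A) (h |: B).
  by rewrite in_symdiff !finset.setU11.
rewrite (neqU1 _ hAB) (neqU1 _ hAhB) symdiffU1l // symdiffU1r // eqU1.
rewrite add0r addr0 setI1U // finset.setIC setI1U // finset.setIC.
by case: ifP => _; rewrite ?addr0 // scalerDr addrC.
Qed.

(** Stem functions of spherical values and spherical derivatives vanish at the
    sets containing [h]; their products thus run over pairs free of [h]. *)
Lemma stem_prod_notin h F G z (K : {set 'I_n}) :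
  (forall A : {set 'I_n}, h \in A -> F z A = 0) ->
  (forall B : {set 'I_n}, h \in B -> G z B = 0) ->
  stem_prod F G z K =
    \sum_(A : {set 'I_n} | h \notin A) \sum_(B : {set 'I_n} | h \notin B)
      if K == symdiff A B then (-1) ^+ #|A :&: B| *: (F z A * G z B) else 0.
Proof.
move=> F0 G0; rewrite stem_prodE [RHS]big_mkcond; apply: eq_bigr => A _.
case: (boolP (h \in A)) => [/F0 FA|_] /=.
  by apply: big1 => B _; rewrite FA mul0r scaler0 if_same.
rewrite [RHS]big_mkcond; apply: eq_bigr => B _.
by case: (boolP (h \in B)) => [/G0 ->|_] //=; rewrite mulr0 scaler0 if_same.
Qed.

(** For [h] in [K] both sides vanish, the symmetric difference of two sets free
    of [h] being free of [h]. *)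
Lemma stem_leibniz h F G z :
  stem_spherical_derivative h (stem_prod F G) z =
    stem_prod (stem_spherical_derivative h F) (stem_spherical_value h G) z
    + stem_prod (stem_spherical_value h F) (stem_spherical_derivative h G) z.
Proof.
have v0 F' (A : {set 'I_n}) : h \in A -> stem_spherical_value h F' z A = 0.
  by move=> hA; rewrite stem_spherical_valueE hA.
have d0 F' (A : {set 'I_n}) : h \in A -> stem_spherical_derivative h F' z A = 0.
  by move=> hA; rewrite stem_spherical_derivativeE hA.
apply/ffunP => K; rewrite [RHS]ffunE.
rewrite (stem_prod_notin K (d0 F) (v0 G)) (stem_prod_notin K (v0 F) (d0 G)).
rewrite -big_split stem_spherical_derivativeE /=.
have [hK|hK] := boolP (h \in K).
  apply/esym/big1 => A hA; rewrite -big_split; apply: big1 => B hB /=.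
  have /negbTE -> : K != symdiff A B; last by rewrite addr0.
  apply: contraTneq hK => ->.
  by rewrite in_symdiff (negbTE hA) (negbTE hB).
rewrite stem_prod_setU1 // scaler_sumr; apply: eq_bigr => A hA.
rewrite scaler_sumr -big_split; apply: eq_bigr => B hB /=.
case: ifP => _; last by rewrite scaler0 addr0.
rewrite !stem_spherical_valueE !stem_spherical_derivativeE hA hB.
by rewrite -scalerAl -scalerAr -!scalerDr !scalerA mulrC.
Qed.

Lemma slice_valueD F F1 F2 z J : F z = F1 z + F2 z ->
  slice_value F z J = slice_value F1 z J + slice_value F2 z J.
Proof.
move=> eF; rewrite /slice_value -big_split; apply: eq_bigr => K _.
by rewrite eF ffunE /bracket mulrDr.
Qed.

End Slice.

Theorem proposition4p7 (R : realType) (n : nat) (D : set 'rV[R[i]]_n)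
    (f g : 'rV[quat R]_n -> quat R) (h : 'I_n) :
  conj_invariant D -> slice D f -> slice D g ->
  forall x : 'rV[quat R]_n, (circularization D `\` real_at_H h) x ->
    spherical_derivative D h (slice_prod D f g) x =
      slice_prod (D `\` real_at_C h)
        (spherical_derivative D h f) (spherical_value D h g) x
      + slice_prod (D `\` real_at_C h)
          (spherical_value D h f) (spherical_derivative D h g) x.
Proof.
move=> invD /stem_ofP[sF _] /stem_ofP[sG _] x [[z [J [Dz uJ ->]]] nx].
set D' := D `\` real_at_C h.
have D'D : D' `<=` D by apply: subDsetl.
have invD' : conj_invariant D' by apply: conj_invariantD.
have D'z : D' z.
  split=> // z0; apply: nx; exists (complex.Re (z 0 h)).
  by rewrite mxE z0 scale0r addr0.
have sV F : stem D F -> stem D (stem_spherical_value h F).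
  exact: stem_spherical_value_stem.
have sD F : stem D F -> stem D' (stem_spherical_derivative h F).
  by move=> sF0; apply: stem_spherical_derivative_stem; apply: stem_sub sF0.
have eV F : stem D F ->
    {in D', stem_of D' (slice_of D (stem_spherical_value h F))
              =1 stem_spherical_value h F}.
  by move=> sF0; apply: stem_of_slice_of => //; apply: sV.
have eD F : stem D F ->
    {in D', stem_of D' (slice_of D' (stem_spherical_derivative h F))
              =1 stem_spherical_derivative h F}.
  by move=> sF0; apply: stem_of_slice_of => //; apply: sD.
have sFG := stem_prod_stem sF sG.
rewrite /slice_prod /spherical_derivative /spherical_value -/D'.
rewrite (slice_of_eq invD' (sD _ sFG)) //; last first.
  move=> y /set_mem/D'D Dy; rewrite /stem_spherical_derivative.
  by rewrite (stem_of_slice_of invD (@subset_refl _ D) sFG) ?inE.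
rewrite (slice_of_eq invD'
  (stem_prod_stem (sD _ sF) (stem_sub D'D (sV _ sG)))) //; last first.
  by move=> y D'y; apply: eq_stem_prod; [apply: eD | apply: eV].
rewrite (slice_of_eq invD'
  (stem_prod_stem (stem_sub D'D (sV _ sF)) (sD _ sG))) //; last first.
  by move=> y D'y; apply: eq_stem_prod; [apply: eV | apply: eD].
exact/slice_valueD/stem_leibniz.
Qed.
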